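(* Let $\Delta = (Q,\Gamma,\delta)$ be a probabilistic pushdown automaton (pPDA) with fundamental PPS $f$. Then $\Delta$ is PAST if and only if there exist $u \in \mathbb{Q}_{\ge 0}^{Q\times\Gamma\times Q}$ and $r \in \mathbb{Q}_{\ge 1}^{Q\times\Gamma}$ such that $f(u) \le u$ and $M_\Delta(u)\, r + \mathbf{1} \le r$ (component-wise).
   Context: A pPDA $\Delta=(Q,\Gamma,\delta)$ has a finite state set $Q$, a finite stack alphabet $\Gamma$, and a finite weighted transition relation $\delta \subseteq Q\times\Gamma\times\mathbb{Q}_{\ge 0}\times Q\times\Gamma^{\le 2}$ ($\Gamma^{\le 2}$: words of length at most 2), where for each $(p,Z,q,\alpha)$ there is at most one $a$ with $(p,Z,a,q,\alpha)\in\delta$; such a transition is written $pZ \xrightarrow{a} q\alpha$. For all $pZ\in Q\times\Gamma$ one requires $\sum_{pZ\xrightarrow{a}q\alpha} a = 1$. Configurations are elements $p\gamma$ of $Q\times\Gamma^*$; each transition $pZ\xrightarrow{a}q\alpha$ and $\beta\in\Gamma^*$ yields a step $pZ\beta \to q\alpha\beta$ of probability $a$; configurations $p\varepsilon$ with empty stack have no outgoing steps. The expected runtime is $\mathsf{ert}[pZ] = \big(\sum_{k\ge 0} T^k(\mathbf{1}-\chi(F))\big)_{pZ}\in[0,\infty]$, where $T$ is the matrix of step probabilities indexed by configurations, $F=Q\times\{\varepsilon\}$ and $\chi(F)$ is the $0/1$ indicator vector of $F$; equivalently, the sum of the probabilities (products of step probabilities) of all finite paths (of any length $\ge 0$) starting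 in $pZ$ that visit only configurations with non-empty stack. $\Delta$ is PAST (positively almost-surely terminating) if $\mathsf{ert}[pZ]<\infty$ for all $pZ\in Q\times\Gamma$. The fundamental PPS $f$ of $\Delta$ is the polynomial map indexed by $Q\times\Gamma\times Q$ given by $$f_{pZq}(x)=\sum_{pZ\xrightarrow{a}q\varepsilon}a+\sum_{pZ\xrightarrow{a}rY}a\,x_{rYq}+\sum_{pZ\xrightarrow{a}rYX}a\sum_{t\in Q}x_{rYt}\,x_{tXq}.$$ For $u$ indexed by $Q\times\Gamma\times Q$, $M_\Delta(u)$ is the $(Q\times\Gamma)\times(Q\times\Gamma)$ matrix defined by $$(M_\Delta(u)\,r)_{pZ}=\sum_{pZ\xrightarrow{a}rY}a\,r_{rY}+\sum_{pZ\xrightarrow{a}rYX}a\Big(r_{rY}+\sum_{t\in Q}u_{rYt}\,r_{tX}\Big)$$ for all vectors $r$ indexed by $Q\times\Gamma$ (in subscripts $r$ also denotes a state). $\mathbf{1}$ is the all-ones vector. *)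

(* Defs.v *)
From HB Require Import structures.
From mathcomp Require Import all_boot all_order all_algebra.
From mathcomp Require Import all_classical all_reals all_analysis.

Set Implicit Arguments.
Unset Strict Implicit.
Unset Printing Implicit Defensive.

Import Order.TTheory GRing.Theory Num.Theory.

Local Open Scope classical_set_scope.
Local Open Scope ring_scope.

(* The weighted transition relation, in which (p, Z, q, alpha) determines the
   weight, is given as a partial function: [delta p Z q alpha = Some a] encodes
   the transition pZ -a-> q alpha, and [None] the absence of a transition. *)
Record pPDA (Q Gamma : finType) : Type := MkPPDA {
  delta : Q -> Gamma -> Q -> 2.-bseq Gamma -> option rat;
  delta_ge0 : forall p Z q alpha a, delta p Z q alpha = Some a -> 0 <= a;
  delta_sum1 : forall p Z, \sum_q \sum_alpha odflt 0 (delta p Z q alpha) = 1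
}.

Section PPDA.
Variables (Q Gamma : finType) (D : pPDA Q Gamma).

Definition weight (p : Q) (Z : Gamma) (q : Q) (alpha : 2.-bseq Gamma) : rat :=
  odflt 0 (delta D p Z q alpha).

(* The configuration p gamma is (p, gamma); the head of gamma is the top of the
   stack. *)
Definition config : Type := (Q * seq Gamma)%type.

(* For fixed beta, at most one alpha satisfies gamma' = alpha beta, so the sum
   below has at most one nonzero term. *)
Definition step_prob (c c' : config) : rat :=
  if c.2 is Z :: beta then
    \sum_(alpha : 2.-bseq Gamma | c'.2 == alpha ++ beta) weight c.1 Z c'.1 alpha
  else 0.

Definition empty_stack : set config := [set c | c.2 = [::]].

Section Runtime.
Variable R : realType.
Local Open Scope ereal_scope.

(* The product T v of the infinite step matrix with a nonnegative vector. *)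
Definition step_mul (v : config -> \bar R) : config -> \bar R :=
  fun c => \esum_(c' in [set: config]) ((ratr (step_prob c c'))%:E * v c').

Definition ert (p : Q) (Z : Gamma) : \bar R :=
  \sum_(0 <= k <oo)
    iter k step_mul (fun c => (1 - \1_empty_stack c)%:E) (p, [:: Z]).

Definition PAST : Prop := forall p Z, ert p Z < +oo.

End Runtime.

Definition fundamental_PPS (x : Q -> Gamma -> Q -> rat) :
    Q -> Gamma -> Q -> rat :=
  fun p Z q =>
    weight p Z q [bseq]
    + \sum_r \sum_Y weight p Z r [bseq Y] * x r Y q
    + \sum_r \sum_Y \sum_X
        weight p Z r [bseq Y; X] * (\sum_t x r Y t * x t X q).

(* The matrix M(u), given by its action on vectors. *)
Definition M_mul (u : Q -> Gamma -> Q -> rat) (v : Q -> Gamma -> rat) :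
    Q -> Gamma -> rat :=
  fun p Z =>
    \sum_r \sum_Y weight p Z r [bseq Y] * v r Y
    + \sum_r \sum_Y \sum_X
        weight p Z r [bseq Y; X] * (v r Y + \sum_t u r Y t * v t X).

End PPDA.

(* Main.v *)
(** Soundness: a certificate (u, r) extends to the function V on configurations
    given by V(p Z beta) = r(pZ) + sum_t u(pZt) V(t beta), which satisfies
    T V + 1 <= V on nonempty stacks, so V bounds every partial sum of ert.

    Completeness uses rational numbers only. The iterates u_n of f from 0
    and r_(n+1) = M(u_n) r_n + 1 are nondecreasing, r_n is bounded by the expected
    runtime and sum_q u_n(pZq) <= 1. A bounded nondecreasing sequence has
    arbitrarily small increments, so some (u, r) = (u_n, r_n) is a certificate up
    to an arbitrarily small d. Since the rows of u sum to at most 1, summing over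
    the final state turns the Jacobian J of f at u into M(u), for which 2r is a
    strict supersolution; hence the iterates v_(k+1) = J v_k + 1 are bounded
    independently of d, and J v + 1/2 <= v for one of them. For small e, the
    pair (u + e v, 2r) absorbs both d and the term quadratic in e. *)

Require Import Defs.
From mathcomp Require Import all_boot all_order all_algebra.
From mathcomp Require Import all_classical all_reals all_analysis.
From mathcomp Require Import lra ring.

Import Order.TTheory GRing.Theory Num.Theory.

Local Open Scope ring_scope.

Set Implicit Arguments.
Unset Strict Implicit.
Unset Printing Implicit Defensive.

(** * Sums over words of length at most 2, and bounded sequences with small increments *)

Lemma sum_bseq2 (T : finType) (V : nmodType) (F : 2.-bseq T -> V) :
  \sum_alpha F alpha =
  F [bseq] + \sum_Y F [bseq Y] + \sum_Y \sum_X F [bseq Y; X].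
Proof.
pose h (x : unit + (T + T * T)) : 2.-bseq T :=
  match x with
  | inl _ => [bseq] | inr (inl Y) => [bseq Y] | inr (inr YX) => [bseq YX.1; YX.2]
  end.
pose g (alpha : 2.-bseq T) : unit + (T + T * T) :=
  match val alpha with
  | Y :: X :: _ => inr (inr (Y, X)) | [:: Y] => inr (inl Y) | [::] => inl tt
  end.
have gK : cancel g h.
  by move=> [[|Y [|X [|? ?]]] //= sz]; apply: val_inj.
have hK : cancel h g by case=> [[]|[Y|[Y X]]].
rewrite (reindex h) /=; last by exists g => x _.
rewrite !big_sumType /= -(pair_bigA _ (fun Y X => F [bseq Y; X])) /= addrA.
by rewrite (big_pred1 tt) => [|[]].
Qed.

(** If every increment exceeded [d], then [s n] would be at least [n * d], which passes [B] by the
    Archimedean property. *)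
Lemma small_step (s : nat -> rat) (B d : rat) :
  0 < d -> 0 <= s 0%N -> (forall n, s n <= B) ->
  exists n, s n.+1 <= s n + d.
Proof.
move=> d0 s0 sB; apply/not_existsP => big.
have lb n : n%:R * d <= s n.
  elim: n => [|n IH]; first by rewrite mul0r.
  have /negP := big n; rewrite -ltNge => /ltW; apply: le_trans.
  by rewrite -natr1; lra.
have B0 : 0 <= B / d := divr_ge0 (le_trans s0 (sB 0%N)) (ltW d0).
have := archi_boundP B0; rewrite ltr_pdivrMr // ltNge => /negP; apply.
exact: le_trans (lb _) (sB _).
Qed.

(** Apply [small_step] to the sum over all coordinates: no coordinate decreases, so the increment of
    the sum dominates that of each coordinate. *)
Lemma small_steps (I : finType) (x : nat -> I -> rat) (B d : rat) :
  0 < d -> (forall i, 0 <= x 0%N i) -> (forall n i, x n i <= x n.+1 i) ->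
  (forall n i, x n i <= B) ->
  exists n, forall i, x n.+1 i <= x n i + d.
Proof.
move=> d0 x0 xS xB.
have [||n Hn] := @small_step (fun n => \sum_i x n i) (\sum_(i : I) B) d d0.
- exact: sumr_ge0.
- by move=> n; apply: ler_sum.
exists n => i; move: Hn; rewrite (bigD1 i) //= [X in _ <= X + _](bigD1 i) //=.
have : \sum_(j | j != i) x n j <= \sum_(j | j != i) x n.+1 j by apply: ler_sum.
lra.
Qed.

(** * Expectations over one transition, in rational arithmetic *)

Section Rational.
Variables (Q Gamma : finType) (D : pPDA Q Gamma).
Local Notation stackfun := (Q -> seq Gamma -> rat).
Implicit Types (u v : Q -> Gamma -> Q -> rat) (r s : Q -> Gamma -> rat).
Implicit Types (G V : stackfun) (h : Q -> rat).

Lemma weight_ge0 p Z q alpha : 0 <= weight D p Z q alpha.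
Proof.
by rewrite /weight; case E: (delta D p Z q alpha) => //=; apply: delta_ge0 E.
Qed.

(** [G] takes arbitrary words, although only words of length at most 2 occur here, so that functions
    recursive on the stack can be plugged in. *)
Definition expect (p : Q) (Z : Gamma) (G : stackfun) : rat :=
  \sum_q \sum_alpha weight D p Z q alpha * G q alpha.

Lemma expectD p Z G1 G2 :
  expect p Z (fun q a => G1 q a + G2 q a) = expect p Z G1 + expect p Z G2.
Proof.
rewrite -big_split; apply: eq_bigr => q _; rewrite -big_split.
by apply: eq_bigr => a _; rewrite mulrDr.
Qed.

Lemma expectZ p Z c G : expect p Z (fun q a => c * G q a) = c * expect p Z G.
Proof.
rewrite mulr_sumr; apply: eq_bigr => q _; rewrite mulr_sumr.
by apply: eq_bigr => a _; rewrite mulrCA.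
Qed.

Lemma expect_cst p Z c : expect p Z (fun _ _ => c) = c.
Proof.
rewrite -[RHS]mul1r -(delta_sum1 D p Z) mulr_suml.
by apply: eq_bigr => q _; rewrite mulr_suml.
Qed.

Lemma expect_sum (I : finType) p Z (G : I -> stackfun) :
  expect p Z (fun q a => \sum_i G i q a) = \sum_i expect p Z (G i).
Proof.
rewrite exchange_big; apply: eq_bigr => q _; rewrite exchange_big.
by apply: eq_bigr => a _; rewrite mulr_sumr.
Qed.

Lemma expect_le p Z G1 G2 :
  (forall q (a : 2.-bseq Gamma), G1 q a <= G2 q a) ->
  expect p Z G1 <= expect p Z G2.
Proof.
move=> le12; apply: ler_sum => q _; apply: ler_sum => a _.
by rewrite ler_wpM2l ?weight_ge0.
Qed.

Lemma eq_expect p Z G1 G2 :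
  (forall q (a : 2.-bseq Gamma), G1 q a = G2 q a) ->
  expect p Z G1 = expect p Z G2.
Proof. by move=> e; apply/le_anti; rewrite !expect_le// => q a; rewrite e. Qed.

Lemma expect_ge0 p Z G :
  (forall q a, 0 <= G q a) -> 0 <= expect p Z G.
Proof. by move=> G0; rewrite -(expect_cst p Z 0) expect_le. Qed.

Lemma expectE p Z G : expect p Z G =
  \sum_q weight D p Z q [bseq] * G q [::]
  + \sum_q \sum_Y weight D p Z q [bseq Y] * G q [:: Y]
  + \sum_q \sum_Y \sum_X weight D p Z q [bseq Y; X] * G q [:: Y; X].
Proof. by rewrite -!big_split /=; apply: eq_bigr => q _; rewrite sum_bseq2. Qed.

(** * Rewards for emptying a stack *)

(* If [u q Y t] is the probability that qY terminates in t, this is the expected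
   total reward for emptying the stack [g] from [q], when consuming the symbol Y
   from state q earns [r q Y] and ending in state t earns [h t]. *)
Fixpoint stack_val u r h (q : Q) (g : seq Gamma) : rat :=
  if g is Y :: g' then r q Y + \sum_t u q Y t * stack_val u r h t g' else h q.

(** With no reward per symbol and an indicator as final reward, the value is the probability of
    emptying the stack in [q], the target state. *)
Definition reach u (q : Q) : stackfun :=
  stack_val u (fun _ _ => 0) (fun t => (t == q)%:R).

Lemma stack_val_ge0 u r h q g :
  (forall p Z t, 0 <= u p Z t) -> (forall p Z, 0 <= r p Z) ->
  (forall p, 0 <= h p) -> 0 <= stack_val u r h q g.
Proof.
move=> u0 r0 h0; elim: g q => //= Y g IH q.
by rewrite addr_ge0// sumr_ge0// => t _; rewrite mulr_ge0.
Qed.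

Lemma reach_ge0 u t q g : (forall p Z t, 0 <= u p Z t) -> 0 <= reach u t q g.
Proof. by move=> u0; apply: stack_val_ge0 => // p; rewrite ler0n. Qed.

Lemma stack_val_le u u' r r' h h' q g :
  (forall p Z t, 0 <= u p Z t <= u' p Z t) ->
  (forall p Z, 0 <= r p Z <= r' p Z) ->
  (forall p, 0 <= h p <= h' p) ->
  stack_val u r h q g <= stack_val u' r' h' q g.
Proof.
move=> uu rr hh.
have u0 p Z t : 0 <= u p Z t by case/andP: (uu p Z t).
have r0 p Z : 0 <= r p Z by case/andP: (rr p Z).
have h0 p : 0 <= h p by case/andP: (hh p).
elim: g q => [|Y g IH] q /=; first by case/andP: (hh q).
apply: lerD; first by case/andP: (rr q Y).
apply: ler_sum => t _; apply: ler_pM => //; first exact: stack_val_ge0.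
by case/andP: (uu q Y t).
Qed.

Lemma sum_delta h q : \sum_t h t * (t == q)%:R = h q.
Proof.
rewrite (bigD1 q) //= eqxx mulr1 big1 ?addr0// => t /negbTE ->.
by rewrite mulr0.
Qed.

Lemma reach1 u t q Y : reach u t q [:: Y] = u q Y t.
Proof. by rewrite /reach /= add0r sum_delta. Qed.

Lemma reach2 u t q Y X : reach u t q [:: Y; X] = \sum_s u q Y s * u s X t.
Proof.
by rewrite /reach /= add0r; apply: eq_bigr => s _; rewrite add0r sum_delta.
Qed.

(** The value is affine in the final reward: the rewards earned on the way, plus [h] weighted by the
    distribution of the final state. *)
Lemma stack_val_split u r h q g :
  stack_val u r h q g =
  stack_val u r (fun=> 0) q g + \sum_t reach u t q g * h t.
Proof.
elim: g q => [|Y g IH] q /=.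
  rewrite add0r -[LHS](sum_delta h); apply: eq_bigr => t _.
  by rewrite /reach /= eq_sym mulrC.
rewrite -addrA; congr (_ + _).
under eq_bigr do rewrite IH mulrDr.
rewrite big_split /=; congr (_ + _).
under eq_bigr do rewrite mulr_sumr.
rewrite exchange_big; apply: eq_bigr => t _.
rewrite /reach /= add0r mulr_suml.
by apply: eq_bigr => s _; rewrite mulrA.
Qed.

(** Writing the PPS, and below [M_mul], as an expectation of one recursive function replaces the
    three-case sums by inductions on words. *)
Lemma fundamental_PPSE u p Z q :
  fundamental_PPS D u p Z q = expect p Z (reach u q).
Proof.
rewrite expectE /fundamental_PPS.
congr (_ + _ + _); first by rewrite (sum_delta (fun t => weight D p Z t [bseq])).
  by do 2!apply: eq_bigr => ? _; rewrite reach1.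
by do 3!apply: eq_bigr => ? _; rewrite reach2.
Qed.

Lemma M_mulE u r p Z :
  M_mul D u r p Z = expect p Z (stack_val u r (fun=> 0)).
Proof.
rewrite expectE /M_mul [X in _ = X + _ + _]big1 => [|q _]; last by rewrite mulr0.
have z q Y : \sum_t u q Y t * 0 = 0 :> rat by apply: big1 => t _; rewrite mulr0.
rewrite add0r; congr (_ + _).
  by do 2!apply: eq_bigr => ? _; rewrite /= z addr0.
do 3!apply: eq_bigr => ? _; congr (_ * (_ + _)).
by apply: eq_bigr => t _; rewrite z addr0.
Qed.

(** This identity links one transition to the pair of [f] and [M]; both directions of the theorem
    rest on it, with [h] the value of the stack below the top symbol. *)
Lemma expect_stack_val u r h p Z :
  expect p Z (stack_val u r h) =
  M_mul D u r p Z + \sum_t fundamental_PPS D u p Z t * h t.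
Proof.
rewrite M_mulE.
under eq_bigr do rewrite fundamental_PPSE mulrC -expectZ.
rewrite -expect_sum -expectD; apply: eq_expect => q a.
by rewrite stack_val_split; under eq_bigr do rewrite mulrC.
Qed.

Lemma stack_val_cat u r h q a b :
  stack_val u r h q (a ++ b) = stack_val u r (fun t => stack_val u r h t b) q a.
Proof.
by elim: a q => //= Y a IH q; congr (_ + _); apply: eq_bigr => t _; rewrite IH.
Qed.

Lemma sum_reach_le1 u q g :
  (forall p Z t, 0 <= u p Z t) -> (forall p Z, \sum_t u p Z t <= 1) ->
  \sum_t reach u t q g <= 1.
Proof.
move=> u0 u1; elim: g q => [|Y g IH] q.
  rewrite /reach /= (bigD1 q) //= eqxx big1 ?addr0// => t /negbTE.
  by rewrite eq_sym => ->.
rewrite /reach /=; under eq_bigr do rewrite add0r.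
rewrite exchange_big; apply: le_trans (u1 q Y); apply: ler_sum => s _.
by rewrite -mulr_sumr; apply: ler_piMr => //; exact: IH.
Qed.

(** * The step operator and truncated runtimes *)

Definition rstep V : stackfun :=
  fun p g => if g is Z :: b then expect p Z (fun q a => V q (a ++ b)) else 0.

(** Horner form of the partial sum with [k] terms of the series for the expected runtime. *)
Fixpoint runtime (k : nat) : stackfun :=
  if k is k'.+1 then fun p g => (g != [::])%:R + rstep (runtime k') p g
  else fun _ _ => 0.

Lemma rstep_ge0 V p g : (forall q b, 0 <= V q b) -> 0 <= rstep V p g.
Proof. by move=> V0; case: g => //= Z b; apply: expect_ge0. Qed.

Lemma rstep_le V V' p g :
  (forall q b, V q b <= V' q b) -> rstep V p g <= rstep V' p g.
Proof. by move=> le; case: g => //= Z b; apply: expect_le. Qed.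

Lemma runtime_ge0 k p g : 0 <= runtime k p g.
Proof. by elim: k p g => //= k IH p g; rewrite addr_ge0 ?ler0n ?rstep_ge0. Qed.

Lemma runtimeS k p g : runtime k p g <= runtime k.+1 p g.
Proof.
elim: k p g => [|k IH] p g; first exact: runtime_ge0.
by rewrite [runtime k.+2]/= [in leLHS]/= lerD2l rstep_le.
Qed.

Lemma runtime_mono k l p g : (k <= l)%N -> runtime k p g <= runtime l p g.
Proof.
move=> /subnKC <-; elim: (l - k)%N => [|n IH]; first by rewrite addn0.
by rewrite addnS (le_trans IH) ?runtimeS.
Qed.

Lemma runtime_sum k p g :
  runtime k p g = \sum_(0 <= j < k) iter j rstep (fun _ b => (b != [::])%:R) p g.
Proof.
elim: k p g => [|k IH] p g; first by rewrite big_geq.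
rewrite big_nat_recl //=; congr (_ + _).
case: g => [|Z b] /=; first by rewrite big1.
rewrite big_mkord -expect_sum; apply: eq_expect => q a.
by rewrite IH big_mkord.
Qed.

Lemma runtime_le_stack_val u r k p g :
  (forall p Z q, 0 <= u p Z q) -> (forall p Z, 0 <= r p Z) ->
  (forall p Z q, fundamental_PPS D u p Z q <= u p Z q) ->
  (forall p Z, M_mul D u r p Z + 1 <= r p Z) ->
  runtime k p g <= stack_val u r (fun=> 0) p g.
Proof.
move=> u0 r0 fu Mr; elim: k p g => [|k IH] p g; first exact: stack_val_ge0.
case: g => [|Z b] /=; first by rewrite addr0.
(* The rest [b] of the stack is turned into a final reward, so that [expect_stack_val] yields [M]
   and [f] and the two certificate inequalities apply. *)
have le : expect p Z (fun q a => runtime k q (a ++ b)) <=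
    expect p Z (stack_val u r (fun t => stack_val u r (fun=> 0) t b)).
  by apply: expect_le => q a; rewrite -stack_val_cat.
apply: le_trans (lerD (lexx _) le) _.
rewrite expect_stack_val addrA [1 + _]addrC lerD// ler_sum// => t _.
by rewrite ler_wpM2r ?stack_val_ge0.
Qed.

(** * Kleene iterates and their comparison with truncated runtimes *)

Fixpoint kleene_u n : Q -> Gamma -> Q -> rat :=
  if n is n'.+1 then fundamental_PPS D (kleene_u n') else fun _ _ _ => 0.

Fixpoint kleene_r n : Q -> Gamma -> rat :=
  if n is n'.+1 then fun p Z => M_mul D (kleene_u n') (kleene_r n') p Z + 1
  else fun _ _ => 0.

Lemma kleene_u_ge0 n p Z q : 0 <= kleene_u n p Z q.
Proof.
elim: n p Z q => //= n IH p Z q; rewrite fundamental_PPSE.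
by apply: expect_ge0 => *; apply: reach_ge0.
Qed.

Lemma M_mul_ge0 u r p Z : (forall p Z q, 0 <= u p Z q) ->
  (forall p Z, 0 <= r p Z) -> 0 <= M_mul D u r p Z.
Proof.
by move=> u0 r0; rewrite M_mulE; apply: expect_ge0 => *; apply: stack_val_ge0.
Qed.

Lemma kleene_r_ge0 n p Z : 0 <= kleene_r n p Z.
Proof.
elim: n p Z => //= n IH p Z.
by rewrite addr_ge0// M_mul_ge0//; apply: kleene_u_ge0.
Qed.

Lemma kleene_uS n p Z q : kleene_u n p Z q <= kleene_u n.+1 p Z q.
Proof.
elim: n p Z q => [|n IH] p Z q; first exact: kleene_u_ge0.
rewrite [leLHS]fundamental_PPSE [leRHS]fundamental_PPSE.
apply: expect_le => t a; apply: stack_val_le => [? ? ?|//|?].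
  by rewrite kleene_u_ge0 IH.
by rewrite ler0n /=.
Qed.

Lemma kleene_rS n p Z : kleene_r n p Z <= kleene_r n.+1 p Z.
Proof.
elim: n p Z => [|n IH] p Z; first exact: kleene_r_ge0.
rewrite /= lerD2r !M_mulE; apply: expect_le => t a.
apply: stack_val_le => [? ? ?|? ?|//]; first by rewrite kleene_u_ge0 kleene_uS.
by rewrite kleene_r_ge0 IH.
Qed.

Lemma sum_kleene_u_le1 n p Z : \sum_q kleene_u n p Z q <= 1.
Proof.
elim: n p Z => [|n IH] p Z; first by rewrite big1.
rewrite /=; under eq_bigr do rewrite fundamental_PPSE.
rewrite -expect_sum -[leRHS](expect_cst p Z).
by apply: expect_le => q a; apply: sum_reach_le1 => // *; apply: kleene_u_ge0.
Qed.

(* [K] is exponential in [n]: every pushed pair of symbols uses the previous [K]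
   twice. *)
Lemma kleene_runtime n : exists K, forall m p Z b,
  kleene_r n p Z + \sum_t kleene_u n p Z t * runtime m t b
  <= runtime (m + K) p (Z :: b).
Proof.
elim: n => [|n [K IH]].
  exists 0%N => m p Z b; rewrite add0r big1 ?runtime_ge0// => t _.
  by rewrite mul0r.
exists (2 * K).+1 => m p Z b; rewrite addnS /= [_ + 1]addrC -addrA lerD2l.
rewrite -expect_stack_val; apply: expect_le => q a.
(* Each symbol of the word costs [K] steps: the bound for the rest [g] serves as the bottom part in
   [IH], with [m + size g * K] in place of [m]. Hence the quantification over [m] and [b]. The extra
   step in the witness pays for the transition itself. *)
have words g : stack_val (kleene_u n) (kleene_r n) (fun t => runtime m t b) q g
    <= runtime (m + size g * K) q (g ++ b).
  elim: g q => [|Y g IHg] q /=; first by rewrite addn0.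
  rewrite mulSn addnCA addnC; apply: le_trans (IH _ _ _ _).
  rewrite lerD2l ler_sum// => t _.
  by rewrite ler_wpM2l ?kleene_u_ge0.
apply: le_trans (words a) _; apply: runtime_mono.
by rewrite leq_add2l leq_mul2r size_bseq orbT.
Qed.

Lemma kleene_r_le_runtime n :
  exists K, forall p Z, kleene_r n p Z <= runtime K p [:: Z].
Proof.
have [K HK] := kleene_runtime n; exists K => p Z.
have := HK 0%N p Z [::]; rewrite big1 ?addr0// => t _.
by rewrite mulr0.
Qed.

(** * The Jacobian of the fundamental PPS and perturbation of approximate certificates *)

(* Derivative of [u |-> reach u q t g] in direction [v]. *)
Fixpoint dreach u v q (t : Q) (g : seq Gamma) : rat :=
  if g is Y :: g' then
    \sum_s (v t Y s * reach u q s g' + u t Y s * dreach u v q s g')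
  else 0.

Lemma dreach_ge0 u v q t g :
  (forall p Z q, 0 <= u p Z q) -> (forall p Z q, 0 <= v p Z q) ->
  0 <= dreach u v q t g.
Proof.
move=> u0 v0; elim: g t => //= Y g IH t; apply: sumr_ge0 => s _.
by rewrite addr_ge0// mulr_ge0// reach_ge0.
Qed.

Lemma dreach_le u v v' q t g :
  (forall p Z q, 0 <= u p Z q) -> (forall p Z q, v p Z q <= v' p Z q) ->
  dreach u v q t g <= dreach u v' q t g.
Proof.
move=> u0 vv; elim: g t => //= Y g IH t; apply: ler_sum => s _.
by rewrite lerD// ?ler_wpM2l// ler_wpM2r// reach_ge0.
Qed.

(* When the rows of [u] sum to at most 1, summing out the final state turns the
   Jacobian of the fundamental PPS into [M_mul D u]. *)
Lemma sum_dreach_le u v t g :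
  (forall p Z q, 0 <= u p Z q) -> (forall p Z q, 0 <= v p Z q) ->
  (forall p Z, \sum_q u p Z q <= 1) ->
  \sum_q dreach u v q t g
  <= stack_val u (fun p Z => \sum_q v p Z q) (fun=> 0) t g.
Proof.
move=> u0 v0 u1; elim: g t => [|Y g IH] t /=; first by rewrite big1.
rewrite exchange_big /= -big_split /=; apply: ler_sum => s _.
rewrite big_split /= -!mulr_sumr lerD ?ler_wpM2l//.
by rewrite ler_piMr// sum_reach_le1.
Qed.

Lemma jacobian_certificate u s :
  (forall p Z q, 0 <= u p Z q) -> (forall p Z, \sum_q u p Z q <= 1) ->
  (forall p Z, 0 <= s p Z) -> (forall p Z, M_mul D u s p Z + 1 <= s p Z) ->
  exists v, [/\ forall p Z q, 0 <= v p Z q,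
    forall p Z, \sum_q v p Z q <= #|Q|%:R * s p Z
    & forall p Z q, expect p Z (dreach u v q) + 2^-1 <= v p Z q].
Proof.
move=> u0 u1 s0 Ms.
pose w k := iter k (fun v p Z q => expect p Z (dreach u v q) + 1)
  (fun (_ : Q) (_ : Gamma) (_ : Q) => 0).
have w0 k p Z q : 0 <= w k p Z q.
  elim: k p Z q => //= k IH p Z q; rewrite addr_ge0//.
  by apply: expect_ge0 => *; apply: dreach_ge0.
have wS k p Z q : w k p Z q <= w k.+1 p Z q.
  elim: k p Z q => [|k IH] p Z q; first exact: w0.
  by rewrite /= lerD2r; apply: expect_le => *; apply: dreach_le.
(* Summed over [q], the constant 1 becomes [#|Q|], which the strict inequality for [s], scaled by
   [#|Q|], absorbs. *)
have wB k p Z : \sum_q w k p Z q <= #|Q|%:R * s p Z.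
  elim: k p Z => [|k IH] p Z; first by rewrite big1// mulr_ge0.
  rewrite /= big_split /= sumr_const -expect_sum -[_ *+ _]mulr_natr mul1r.
  apply: le_trans (ler_wpM2l _ (Ms p Z)) => //.
  rewrite mulrDr mulr1 lerD2r M_mulE -expectZ; apply: expect_le => q a.
  apply: le_trans (sum_dreach_le _ _ _ _ _) _ => //.
  elim: (val a) q => [|Y g IHg] q /=; first by rewrite mulr0.
  rewrite mulrDr mulr_sumr lerD//; apply: ler_sum => t _.
  by rewrite mulrCA ler_wpM2l.
have sB p Z : s p Z <= \sum_p' \sum_Z' s p' Z'.
  rewrite (bigD1 p) //= (bigD1 Z) //= -addrA lerDl addr_ge0 ?sumr_ge0//.
  by move=> *; rewrite sumr_ge0.
(* An increment of at most 1/2 leaves half of the constant 1 added by each iteration as slack. *)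
have [|i||k i|k Hk] := @small_steps (Q * Gamma * Q)%type
  (fun k i => w k i.1.1 i.1.2 i.2) (#|Q|%:R * \sum_p' \sum_Z' s p' Z') 2^-1.
- by [].
- by [].
- by [].
- apply: le_trans (le_trans (wB k i.1.1 i.1.2) _); last by rewrite ler_wpM2l.
  by rewrite (bigD1 i.2) //= lerDl sumr_ge0.
exists (w k); split=> // p Z q.
by have := Hk (p, Z, q); rewrite /=; lra.
Qed.

(** Taylor expansion: on words of length at most 2, [reach] has degree at most 2 in [u]. The
    remainder is [e ^+ 2] times a sum over the intermediate state of products of two entries of
    [v]. *)
Lemma reach_perturb u v (e C : rat) q t (a : 2.-bseq Gamma) :
  0 <= e -> (forall p Z q, 0 <= v p Z q <= C) ->
  reach (fun p Z q => u p Z q + e * v p Z q) q t a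
  <= reach u q t a + e * dreach u v q t a + e ^+ 2 * (#|Q|%:R * C ^+ 2).
Proof.
move=> e0 vC.
have v0 p Z q' : 0 <= v p Z q' by case/andP: (vC p Z q').
have v1 p Z q' : v p Z q' <= C by case/andP: (vC p Z q').
have rem0 : 0 <= e ^+ 2 * (#|Q|%:R * C ^+ 2).
  by rewrite mulr_ge0 ?sqr_ge0// mulr_ge0 ?sqr_ge0.
have d1 p X : dreach u v q p [:: X] = v p X q.
  rewrite /= -[RHS](sum_delta (v p X)).
  by apply: eq_bigr => s _; rewrite mulr0 addr0.
case: a => [[|Y [|X [|? ?]]] //= _].
- by rewrite /reach /=; lra.
- by have /= -> := d1 t Y; rewrite !reach1; lra.
rewrite !reach2 mulr_sumr -big_split /=.
have -> : e ^+ 2 * (#|Q|%:R * C ^+ 2) = \sum_(s : Q) e ^+ 2 * C ^+ 2.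
  by rewrite sumr_const -[_ *+ _]mulr_natr; ring.
rewrite -big_split /=; apply: ler_sum => s _.
have /= -> := d1 s X; rewrite reach1.
have : e ^+ 2 * (v t Y s * v s X q) <= e ^+ 2 * C ^+ 2.
  by rewrite ler_wpM2l ?sqr_ge0// expr2 ler_pM.
set U1 := u _ _ _; set U2 := u _ _ _.
set V1 := v _ _ _; set V2 := v _ _ _ => le; apply: le_trans (lerD (lexx _) le).
by rewrite le_eqVlt; apply/orP; left; apply/eqP; ring.
Qed.

(** With zero final reward and at most two symbols, only the row of [u] at the first symbol meets a
    reward, so the value is affine in [u]. *)
Lemma stack_val_perturb u v s (e C S : rat) t (a : 2.-bseq Gamma) :
  0 <= e -> 0 <= C -> 0 <= S -> (forall p Z q, 0 <= v p Z q <= C) ->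
  (forall p Z, 0 <= s p Z <= S) ->
  stack_val (fun p Z q => u p Z q + e * v p Z q) s (fun=> 0) t a
  <= stack_val u s (fun=> 0) t a + e * (#|Q|%:R * (C * S)).
Proof.
move=> e0 C0 S0 vC sS.
have v0 p Z q : 0 <= v p Z q by case/andP: (vC p Z q).
have v1 p Z q : v p Z q <= C by case/andP: (vC p Z q).
have s0 p Z : 0 <= s p Z by case/andP: (sS p Z).
have s1 p Z : s p Z <= S by case/andP: (sS p Z).
have -> : e * (#|Q|%:R * (C * S)) = \sum_(q : Q) e * (C * S).
  by rewrite sumr_const -[_ *+ _]mulr_natr; ring.
have CS0 : 0 <= e * (C * S) := mulr_ge0 e0 (mulr_ge0 C0 S0).
case: a => [[|Y [|X [|? ?]]] //= _].
- by rewrite add0r sumr_ge0.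
all: have z (x : Q -> rat) : \sum_q x q * 0 = 0 by apply: big1 => q _; rewrite mulr0.
all: rewrite -addrA lerD2l.
  by rewrite !z add0r sumr_ge0.
rewrite -big_split /=; apply: ler_sum => q _; rewrite !z !addr0 mulrDl lerD2l.
by rewrite -mulrA ler_wpM2l// ler_pM.
Qed.

Lemma bounded_kleene_certificate (B : rat) :
  (forall n p Z, kleene_r n p Z <= B) ->
  exists u r,
    [/\ forall p Z q, 0 <= u p Z q,
        forall p Z, 1 <= r p Z,
        forall p Z q, fundamental_PPS D u p Z q <= u p Z q
      & forall p Z, M_mul D u r p Z + 1 <= r p Z].
Proof.
(* The bound can be negative only if there is no pair of a state and a symbol. *)
move=> rB; wlog B0 : B rB / 0 <= B => [/(_ (Num.max 0 B))|].
  by apply=> [n p Z|]; rewrite le_max ?lexx// rB orbT.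
pose N : rat := #|Q|%:R; have N0 : 0 <= N by rewrite ler0n.
(* [C] will bound the entries of [v], [A] the quadratic term of [f], and [L] the change of [M] per
   unit of [e]. They depend only on [B] and [#|Q|], so [e] can be fixed before the iterate is
   chosen; it makes [e], [e * A] and [e * L] at most 1/4. *)
pose C := N * (2 * B); pose A := N * C ^+ 2; pose L := N * (C * (2 * B)).
have C0 : 0 <= C by rewrite !mulr_ge0.
have A0 : 0 <= A by rewrite mulr_ge0// sqr_ge0.
have L0 : 0 <= L by rewrite !mulr_ge0.
pose k := 4 * (1 + A + L); have k0 : 0 < k by rewrite /k; lra.
pose e := k^-1; have e0 : 0 < e by rewrite invr_gt0.
have ek : e * (4 * (1 + A + L)) = 1 by rewrite /e mulVf// gt_eqF.
have eA0 : 0 <= e * A by rewrite mulr_ge0// ltW.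
have eL0 : 0 <= e * L by rewrite mulr_ge0// ltW.
(* The sum type provides a single index [n] at which both sequences are nearly stationary. *)
have [|i|n [i|i]|n [i|i]|n Hn] := @small_steps (Q * Gamma * Q + Q * Gamma)%type
  (fun n i => match i with inl j => kleene_u n j.1.1 j.1.2 j.2
                         | inr j => kleene_r n j.1 j.2 end) (1 + B) (e / 4).
- by rewrite divr_gt0.
- by case: i.
- exact: kleene_uS.
- exact: kleene_rS.
- apply: le_trans (le_trans (sum_kleene_u_le1 n i.1.1 i.1.2) _).
    rewrite (bigD1 i.2) //= lerDl sumr_ge0// => q _; exact: kleene_u_ge0.
  by rewrite lerDl.
- by apply: le_trans (rB _ _ _) _; rewrite lerDr.
have Hu p Z q : fundamental_PPS D (kleene_u n) p Z q <= kleene_u n p Z q + e / 4.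
  exact: Hn (inl (p, Z, q)).
have Hr p Z : M_mul D (kleene_u n) (kleene_r n) p Z + 1 <= kleene_r n p Z + e / 4.
  exact: Hn (inr (p, Z)).
move: (kleene_u n) (kleene_r n) (kleene_u_ge0 n) (kleene_r_ge0 n)
  (sum_kleene_u_le1 n) (rB n) Hu Hr => u r u0 r0 u1 {}rB Hu Hr.
have e1 : e <= 1 / 4 by move: ek eA0 eL0; lra.
(* Doubling [r] doubles the constant 1: the surplus 1 pays for the doubled defect [e / 2] and for
   the change [e * L] of [M]. *)
pose s p Z := 2 * r p Z.
have s0 p Z : 0 <= s p Z by rewrite mulr_ge0.
have sB p Z : s p Z <= 2 * B by rewrite ler_wpM2l.
have Ms p Z : M_mul D u s p Z <= 2 * (r p Z + e / 4 - 1).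
  apply: le_trans (_ : 2 * M_mul D u r p Z <= _); last by have := Hr p Z; lra.
  rewrite !M_mulE -expectZ; apply: expect_le => q a.
  elim: (val a) q => [|Y g IHg] q /=; first by rewrite mulr0.
  rewrite mulrDr mulr_sumr lerD//; apply: ler_sum => t _.
  by rewrite mulrCA ler_wpM2l.
have [p Z|v [v0 vs Jv]] := @jacobian_certificate u s u0 u1 s0.
  by have := Ms p Z; rewrite /s; move: e1; lra.
have vC p Z q : 0 <= v p Z q <= C.
  rewrite v0 /=; apply: le_trans (le_trans (vs p Z) _).
    by rewrite (bigD1 q) //= lerDl sumr_ge0.
  by rewrite ler_wpM2l.
pose u' p Z q := u p Z q + e * v p Z q.
have u'0 p Z q : 0 <= u' p Z q by rewrite addr_ge0// mulr_ge0// ltW.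
have Mu' p Z : M_mul D u' s p Z + 1 <= s p Z.
  have : M_mul D u' s p Z <= M_mul D u s p Z + e * L.
    rewrite !M_mulE -(expect_cst p Z (e * L)) -expectD.
    apply: expect_le => q a; apply: stack_val_perturb => //; first exact: ltW.
      by rewrite mulr_ge0.
    by move=> p' Z'; rewrite s0 sB.
  by have := Ms p Z; rewrite /s; move: e1 ek eA0 eL0; lra.
exists u', s; split=> // [p Z|p Z q].
  by apply: le_trans (Mu' p Z); rewrite lerDr M_mul_ge0.
(* The slack 1/2 in the Jacobian inequality gains [e / 2]: one half covers the defect [e / 4] of
   [u], the other the quadratic term. *)
have : fundamental_PPS D u' p Z q <=
    fundamental_PPS D u p Z q + e * expect p Z (dreach u v q) + e ^+ 2 * A.
  rewrite !fundamental_PPSE -(expect_cst p Z (e ^+ 2 * A)) -expectZ -!expectD.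
  by apply: expect_le => t a; apply: reach_perturb => //; exact: ltW.
have : e * (expect p Z (dreach u v q) + 2^-1) <= e * v p Z q.
  by rewrite ler_wpM2l// ltW.
have : e ^+ 2 * A <= e / 4.
  by rewrite expr2 -mulrA ler_wpM2l ?ltW//; move: ek eL0 e0; lra.
by have := Hu p Z q; rewrite /u' mulrDr; lra.
Qed.
End Rational.

(** * Transfer to the extended reals: sums over all configurations and [ert] *)

Section Extended.
Variables (R : realType) (Q Gamma : finType) (D : pPDA Q Gamma).
Local Open Scope ereal_scope.
Local Notation toE x := ((ratr x : R)%:E).

Lemma toE_sum (I : Type) (s : seq I) (P : pred I) (F : I -> rat) :
  toE (\sum_(i <- s | P i) F i)%R = \sum_(i <- s | P i) toE (F i).
Proof. by rewrite raddf_sum /= sumEFin. Qed.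

(** Each configuration has finitely many successors: after exchanging the sum over configurations
    with the one over transitions, every transition contributes at a single configuration. *)
Lemma step_mul_rat (V : Q -> seq Gamma -> rat) (c : config Q Gamma) :
  (forall p g, 0 <= V p g)%R ->
  step_mul D (fun c => toE (V c.1 c.2)) c = toE (rstep D V c.1 c.2).
Proof.
move=> V0; case: c => p [|Z b]; rewrite /step_mul /step_prob /=.
  by rewrite esum1 ?raddf0// => c _; rewrite mul0e.
pose F (c : config Q Gamma) (i : Q * 2.-bseq Gamma) : \bar R :=
  if c == (i.1, val i.2 ++ b)
  then toE (weight D p Z i.1 i.2 * V i.1 (val i.2 ++ b))%R
  else 0.
have F0 c i : 0 <= F c i.
  by rewrite /F; case: ifP => // _; rewrite lee_fin ler0q mulr_ge0 ?weight_ge0.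
transitivity (\esum_(c in [set: config Q Gamma]) \sum_i F c i).
  apply: eq_esum => -[q g] _ /=.
  rewrite -EFinM -rmorphM mulr_suml toE_sum.
  rewrite -(pair_bigA _ (fun t a => F (q, g) (t, a))) /= (bigD1 q) //=.
  rewrite [X in _ + X]big1 ?adde0 => [|t tq].
    rewrite big_mkcond; apply: eq_bigr => a _; rewrite /F /= xpair_eqE eqxx /=.
    by case: eqP => // ->.
  by rewrite big1// => a _; rewrite /F xpair_eqE eq_sym (negbTE tq).
rewrite esum_sum// -(pair_bigA _ (fun q a => \esum_(c in _) F c (q, a))) /=.
rewrite toE_sum; apply: eq_bigr => q _; rewrite toE_sum; apply: eq_bigr => a _.
transitivity (\esum_(c in [set (q, val a ++ b)]) F c (q, a)).
  rewrite [RHS]esum_mkcond; apply: eq_esum => c _; rewrite /F /=.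
  by case: eqP => [->|_]; [rewrite mem_set|case: ifP].
by rewrite esum_set1 /F ?eqxx// lee_fin ler0q mulr_ge0 ?weight_ge0.
Qed.

Lemma iter_step_mul (k : nat) (c : config Q Gamma) :
  iter k (step_mul D (R := R)) (fun c => (1 - \1_(@empty_stack Q Gamma) c)%:E) c =
  toE (iter k (rstep D) (fun _ b => (b != [::])%:R)%R c.1 c.2).
Proof.
have it0 j p g : (0 <= iter j (rstep D) (fun _ b => (b != [::])%:R) p g)%R.
  by elim: j p g => [|j IH] p g /=; [rewrite ler0n|rewrite rstep_ge0].
elim: k c => [|k IH] c.
  rewrite /= rmorph_nat indicE; congr (_%:E).
  have -> : (c \in @empty_stack Q Gamma) = (c.2 == [::]).
    by apply/idP/eqP; rewrite inE.
  by case: eqP => _; rewrite ?subrr ?subr0.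
by rewrite /= -step_mul_rat//; congr step_mul; apply/funext.
Qed.

Lemma ert_partial_sum (k : nat) (p : Q) (Z : Gamma) :
  \sum_(0 <= j < k) iter j (step_mul D (R := R))
    (fun c => (1 - \1_(@empty_stack Q Gamma) c)%:E) (p, [:: Z]) =
  toE (runtime D k p [:: Z]).
Proof.
by rewrite runtime_sum toE_sum; apply: eq_bigr => j _; rewrite iter_step_mul.
Qed.

Lemma iter_step_mul_ge0 (k : nat) (c : config Q Gamma) :
  0 <= iter k (step_mul D (R := R))
    (fun c => (1 - \1_(@empty_stack Q Gamma) c)%:E) c.
Proof.
rewrite iter_step_mul lee_fin ler0q; elim: k c.1 c.2 => [|k IH] p g /=.
  by rewrite ler0n.
exact: rstep_ge0.
Qed.

Lemma runtime_le_ert k p Z : toE (runtime D k p [:: Z]) <= ert D R p Z.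
Proof.
by rewrite -ert_partial_sum; apply: nneseries_lim_ge => j _ _;
  exact: iter_step_mul_ge0.
Qed.

Lemma ert_le p Z (B : rat) :
  (forall k, runtime D k p [:: Z] <= B)%R -> ert D R p Z <= toE B.
Proof.
move=> leB; apply: lime_le.
  by apply: is_cvg_nneseries => j _ _; exact: iter_step_mul_ge0.
by apply: nearW => k; rewrite ert_partial_sum lee_fin ler_rat.
Qed.

(** Expected runtimes are real and may be irrational, so a natural number above their finite sum
    serves as the common rational bound. *)
Lemma PAST_runtime_bounded :
  PAST D R -> exists B : rat, forall k p Z, (runtime D k p [:: Z] <= B)%R.
Proof.
move=> past.
have fin p Z : ert D R p Z \is a fin_num.
  rewrite ge0_fin_numE//; apply: nneseries_ge0 => j _ _; exact: iter_step_mul_ge0.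
pose b p Z := fine (ert D R p Z).
have b0 p Z : (0 <= b p Z)%R.
  by apply: fine_ge0; apply: nneseries_ge0 => j _ _; exact: iter_step_mul_ge0.
pose S := (\sum_p \sum_Z b p Z)%R.
have S0 : (0 <= S)%R by apply: sumr_ge0 => p _; apply: sumr_ge0.
exists (Num.bound S)%:R%R => k p Z.
rewrite -(ler_rat R) ratr_nat; apply: le_trans (ltW (archi_boundP S0)).
apply: le_trans (_ : b p Z <= _)%R.
  by rewrite -lee_fin fineK// runtime_le_ert.
rewrite /S (bigD1 p) //= (bigD1 Z) //= -addrA lerDl addr_ge0 ?sumr_ge0//.
by move=> *; rewrite sumr_ge0.
Qed.

End Extended.

Theorem theorem8 (R : realType) (Q Gamma : finType) (D : pPDA Q Gamma) :
  PAST D R <->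
  exists (u : Q -> Gamma -> Q -> rat) (r : Q -> Gamma -> rat),
    [/\ forall p Z q, 0 <= u p Z q,
        forall p Z, 1 <= r p Z,
        forall p Z q, fundamental_PPS D u p Z q <= u p Z q
      & forall p Z, M_mul D u r p Z + 1 <= r p Z].
Proof.
split=> [/PAST_runtime_bounded[B HB]|[u [r [u0 r1 fu Mr]]] p Z].
  apply: (@bounded_kleene_certificate _ _ D B) => n p Z.
  by have [K HK] := kleene_r_le_runtime D n; apply: le_trans (HK p Z) (HB K p Z).
apply: le_lt_trans (ltry (ratr (stack_val u r (fun=> 0) p [:: Z]))).
apply: ert_le => k; apply: runtime_le_stack_val => // q Y.
exact: le_trans ler01 (r1 q Y).
Qed.
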